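(* For the Hermite polynomials $H_n(x)$ and every natural number $n\ge 1$ we have \[H_{n}(x)= \left|\begin{array}{cccccc} 2x&-2&0&\cdots&0&0\\ -1&2x&-4&\cdots&0&0\\ 0&-1&2x&\cdots&0&0\\ \vdots&\vdots&\vdots&\ddots&\vdots&\vdots\\ 0&0&0&\cdots&2x&-2(n-1)\\ 0&0&0&\cdots&-1&2x\end{array}\right|,\] where the determinant has size $n$; that is, the matrix is the $n\times n$ tridiagonal matrix with all diagonal entries equal to $2x$, all subdiagonal entries equal to $-1$, and $(i,i+1)$ entry equal to $-2i$ for $1\le i\le n-1$.
   Context: The Hermite polynomials are defined by $H_0(x)=1$, $H_1(x)=2x$, and $H_{n+1}(x)=-2nH_{n-1}(x)+2xH_n(x)$ for $n\ge 1$. *)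

(* Defs.v *)
From HB Require Import structures.
From mathcomp Require Import all_boot all_order all_algebra.

Set Implicit Arguments.
Unset Strict Implicit.
Unset Printing Implicit Defensive.

Import GRing.Theory.
Local Open Scope ring_scope.

(* Physicists' Hermite polynomials, over an arbitrary nontrivial commutative
   ring.  With n = m.+1 the last case reads
   H_(n+1) = - 2 n H_(n-1) + 2 X H_n, for n >= 1. *)
Fixpoint hermite (R : comNzRingType) (k : nat) : {poly R} :=
  match k with
  | 0 => 1
  | n.+1 =>
      match n with
      | 0 => 2%:R * 'X
      | m.+1 => - (2 * n)%:R * hermite R m + 2%:R * 'X * hermite R n
      end
  end.

(* Indices start at 0, so the 1-based entry (i, i + 1), equal to - 2 i, is
   - 2 (i + 1) here. *)
Definition hermite_mx (R : comNzRingType) (n : nat) : 'M[{poly R}]_n :=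
  \matrix_(i < n, j < n)
    if j == i :> nat then 2%:R * 'X
    else if i == j.+1 :> nat then -1
    else if j == i.+1 :> nat then - (2 * i.+1)%:R
    else 0.

(* Main.v *)
Require Import Defs.
From mathcomp Require Import all_boot all_order all_algebra.
From mathcomp Require Import zify.

(** The determinants of the leading principal blocks of a tridiagonal matrix
    satisfy a three-term recurrence (they are continuants): expanding along the
    last row, and then along the last column in the one minor that is not
    principal, gives
      D_(n+2) = a_(n+1,n+1) D_(n+1) - a_(n+1,n) a_(n,n+1) D_n.
    For the entries 2x, -1 and -2(n+1) this is exactly the recurrence that
    defines the Hermite polynomials, since (-1) * (-2(n+1)) = 2(n+1).  The
    blocks of sizes 0 and 1 have determinants 1 and 2x, so both sequences start
    with the same values; [det_tridiagonal_rec] carries the argument. *)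

Import GRing.Theory.
Local Open Scope ring_scope.

(** The entries come from a function on [nat] so that the blocks of all sizes
    are truncations of one infinite matrix, and so that deleting the last row
    and column yields literally the block of the previous size. *)
Lemma det_tridiagonal_rec (A : comNzRingType) (f : nat -> nat -> A) (n : nat) :
  (forall i j, (i.+1 < j)%N || (j.+1 < i)%N -> f i j = 0) ->
  \det (\matrix_(i < n.+2, j < n.+2) f i j) =
    f n.+1 n.+1 * \det (\matrix_(i < n.+1, j < n.+1) f i j)
    - f n.+1 n * f n n.+1 * \det (\matrix_(i < n, j < n) f i j).
Proof.
move=> f0.
have bump_id (h : nat) : bump h h = h.+1 by rewrite /bump leqnn.
have bump_max (h k : nat) : (k < h)%N -> bump h k = k.
  by move=> lt_kh; rewrite /bump leqNgt lt_kh.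
rewrite (expand_det_row _ ord_max) big_ord_recr big_ord_recr /=.
rewrite big1 ?add0r => [|j _]; last by rewrite mxE f0 ?mul0r //= !ltnS ltn_ord orbT.
rewrite !mxE /= addrC; congr (_ + _).
  rewrite /cofactor -signr_odd oddD addbb mul1r; congr (_ * \det _).
  by apply/matrixP=> i j; rewrite !mxE !lift_max.
(* In the minor at (n+1, n) the last column is column n+1 of the matrix, whose
   only surviving entry is the superdiagonal one, in the last row. *)
rewrite /cofactor /= -signr_odd addSn /= oddD addbb /= expr1 mulN1r mulrN.
congr (- _); rewrite -mulrA; congr (_ * _).
rewrite (expand_det_col _ ord_max) big_ord_recr /=.
rewrite big1 ?add0r => [|i _]; last first.
  have lt_in := ltn_ord i.
  by rewrite !mxE /= bump_id (bump_max _ _ (leqW lt_in)) f0 ?mul0r // !ltnS lt_in.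
rewrite !mxE /= bump_id bump_max //; congr (_ * _).
rewrite /cofactor -signr_odd oddD addbb mul1r; congr (\det _).
apply/matrixP=> i j; rewrite !mxE /=.
have lt_in := ltn_ord i; have lt_jn := ltn_ord j.
by rewrite !(bump_max _ _ lt_in, bump_max _ _ lt_jn) (bump_max _ _ (leqW lt_in)).
Qed.

Lemma det_hermite_mx_rec (R : comNzRingType) (n : nat) :
  \det (hermite_mx R n.+2) =
    - (2 * n.+1)%:R * \det (hermite_mx R n)
    + 2%:R * 'X * \det (hermite_mx R n.+1).
Proof.
rewrite /hermite_mx.
pose f (i j : nat) : {poly R} :=
  if j == i then 2%:R * 'X
  else if i == j.+1 then -1
  else if j == i.+1 then - (2 * i.+1)%:R
  else 0.
rewrite (@det_tridiagonal_rec _ f) => [|i j]; last first.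
  by move=> far; rewrite /f; do 3 (case: ifP => [|_]; first by lia).
have f_diag : f n.+1 n.+1 = 2%:R * 'X by rewrite /f eqxx.
have f_sub : f n.+1 n = -1 by rewrite /f eqxx ltn_eqF.
have f_sup : f n n.+1 = - (2 * n.+1)%:R.
  by rewrite /f eqxx gtn_eqF // ltn_eqF // ltnS leqnSn.
by rewrite f_diag f_sub f_sup mulN1r opprK mulNr addrC.
Qed.

Theorem proposition2p7 (R : comNzRingType) (n : nat) (n_ge1 : (1 <= n)%N) :
  hermite R n = \det (hermite_mx R n).
Proof.
clear n_ge1.
(* The recurrence has order two, so two consecutive values are carried along. *)
suff: hermite R n = \det (hermite_mx R n)
      /\ hermite R n.+1 = \det (hermite_mx R n.+1) by case.
elim: n => [|n [IHn IHn1]]; first by rewrite det_mx00 det_mx11 mxE.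
by split=> //; rewrite det_hermite_mx_rec -IHn -IHn1.
Qed.
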